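(* Let $N \ge 1$ and fix a Hermitian matrix $A \in \mathbb{C}^{N\times N}$ that is $3$-PMP. Let $\pi := \pi^{\{1\}}(A) = \{I_1,\ldots,I_m\}$ and let $\pi' = \{I'_1,\ldots,I'_{m'}\}$ be any partition of $\{1,\ldots,N\}$ refined by $\pi$ (that is, $\pi$ is a refinement of $\pi'$). Let $X$ denote the set of entries of $A$ and suppose $\mathcal{F}$ is a family of complex-valued functions on $X$ that has full determinantal rank over the entries of each row of $A$. Then the following spaces are equal. (1) The simultaneous kernel of $f[A]$ for all $f \in \mathcal{F}$. (2) The simultaneous kernel of $f[A]$ for all functions $f : X \to \mathbb{C}$. (3) The simultaneous kernel of the block-diagonal matrices $f[\operatorname{diag} A_{\pi'}] := \bigoplus_{j=1}^{m'} f[A_{I'_j \times I'_j}]$ for all functions $f : X \to \mathbb{C}$. (4) The kernel of $J_\pi := \bigoplus_{j=1}^m \mathbf{1}_{I_j \times I_j}$. This equality of kernels need not hold for matrices that are not $3$-PMP.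
   Context: For an integer $k \ge 0$, a complex Hermitian matrix is $k$-PMP if every $l \times l$ principal minor is non-negative, for all $l \in \{1,\ldots,k\}$. For $A \in \mathbb{C}^{N \times N}$, $\pi^{\{1\}}(A)$ is the unique coarsest partition $\{I_1,\ldots,I_m\}$ of $\{1,\ldots,N\}$ such that $A$ is constant on each block $I_i \times I_j$. $f[A]$ is the matrix obtained by applying $f$ to each entry of $A$. $A_{I\times I}$ is the principal submatrix indexed by $I$; $\mathbf{1}_{I \times I}$ is the matrix indexed by $I \times I$ with all entries $1$; the direct sums are the $N \times N$ block-diagonal matrices whose diagonal blocks sit in the positions $I'_j \times I'_j$ (respectively $I_j \times I_j$), with zeros elsewhere. Full determinantal rank: a set $\mathcal{F}$ of complex-valued functions has full determinantal rank over a non-empty set $Y$ contained in their domain if, for any $k$ distinct points $x_1,\ldots,x_k \in Y$, where $k \le |\mathcal{F}|$, there exist functions $f_1,\ldots,f_k \in \mathcal{F}$ such that the determinant $\det(f_i(x_j))_{i,j=1}^k$ is not a zero divisor, that is, is non-zero.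
   Formalization: In ''full determinantal rank'', k ≤ |F| is required for all k distinct points of Y rather than restricting k, so F must have at least as many functions as each row has distinct entries; otherwise A = the 2×2 identity with F = {1} is a counterexample. *)

(* Defs.v *)
From HB Require Import structures.
From mathcomp Require Import all_boot all_order all_algebra.
From mathcomp Require Import all_classical reals.
From mathcomp Require Export complex.

Set Implicit Arguments.
Unset Strict Implicit.
Unset Printing Implicit Defensive.

Import Order.TTheory GRing.Theory Num.Theory.
Local Open Scope ring_scope.
Local Open Scope complex_scope.
Local Open Scope classical_set_scope.
Local Open Scope card_scope.

(* Set partitions of {1,...,N} are {set {set 'I_N}} with finset's [partition]
   (disjoint nonempty blocks covering everything). *)
Definition is_partition (N : nat) (P : {set {set 'I_N}}) : bool :=
  finset.partition P finset.setT.

Definition refines (N : nat) (P Q : {set {set 'I_N}}) : Prop :=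
  forall B, B \in P -> exists2 C, C \in Q & B \subset C.

Section Matrices.
Variables (R : realType) (N : nat).
Local Notation C := R[i].
Implicit Types (A M : 'M[C]_N) (P : {set {set 'I_N}}).

(* On C = R[i], 0 <= z means that z is real and non-negative. *)
Definition pmp (k : nat) A : Prop :=
  forall l, (1 <= l <= k)%N ->
  forall I : {set 'I_N}, #|I| = l ->
    0 <= \det (mxsub (@enum_val _ (mem I)) (@enum_val _ (mem I)) A).

Definition block_constant A P : Prop :=
  forall I J, I \in P -> J \in P ->
  exists c : C, forall i j, i \in I -> j \in J -> A i j = c.

Definition is_pi1 A P : Prop :=
  [/\ is_partition P, block_constant A P &
      forall Q : {set {set 'I_N}},
        is_partition Q -> block_constant A Q -> refines Q P].

Definition entries A : set C := [set A i j | i in [set: 'I_N] & j in [set: 'I_N]].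

Lemma entry_subproof A i j : A i j \in entries A.
Proof. by rewrite inE; exists i => //; exists j. Qed.

(* [entries A] coerces to the type of its elements, so that the functions
   defined on the set of entries are exactly the terms of [entries A -> C]. *)
Definition entry A (i j : 'I_N) : entries A :=
  exist _ (A i j) (entry_subproof A i j).

Definition row_entries A (i : 'I_N) : set (entries A) := range (entry A i).

Definition apply_mx A (f : entries A -> C) : 'M[C]_N :=
  \matrix_(i, j) f (entry A i j).

(* The direct sum of the diagonal blocks M_{I x I}, for I in P. *)
Definition block_diag P M : 'M[C]_N :=
  \matrix_(i, j)
    (if [exists B in P, (i \in B) && (j \in B)] then M i j else 0).

Definition mxker M : set 'cV[C]_N := [set v | M *m v = 0].

Definition simker T (F : set T) (M : T -> 'M[C]_N) : set 'cV[C]_N :=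
  \bigcap_(f in F) mxker (M f).

End Matrices.

Arguments entries {R N} A.
Arguments row_entries {R N} A i.
Arguments apply_mx {R N} A f.

(* The bound k <= |F| is part of what is asserted for each choice of k distinct
   points of Y, so F has at least as many elements as every finite subset of
   Y. If it merely restricted the range of k, the family F = {1} would have
   full determinantal rank over every Y. *)
Definition full_det_rank (R : realType) (D : Type)
    (F : set (D -> R[i])) (Y : set D) : Prop :=
  forall (k : nat) (x : 'I_k -> D), injective x -> (forall j, Y (x j)) ->
  [set: 'I_k] #<= F /\
  exists f : 'I_k -> (D -> R[i]),
    (forall i, F (f i)) /\ \det (\matrix_(i, j) f i (x j)) != 0.

Lemma is_pi1_unique (R : realType) (N : nat) (A : 'M[R[i]]_N)
    (P Q : {set {set 'I_N}}) : is_pi1 A P -> is_pi1 A Q -> P = Q.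
Proof.
suff sub P' Q' : is_pi1 A P' -> is_pi1 A Q' -> {subset P' <= Q'}.
  by move=> hP hQ; apply/setP => B; apply/idP/idP; apply: sub.
case=> partP cP maxP [partQ cQ maxQ] B BP.
have [C CQ BC] := maxQ _ partP cP _ BP.
have [D DP CD] := maxP _ partQ cQ _ CQ.
suff -> : B = C by [].
apply/eqP; rewrite finset.eqEsubset BC /=.
have /and3P[_ tI n0] := partP.
have /set0Pn[x xB] : B != finset.set0 by apply: contraNneq n0 => <-.
suff -> : B = D by [].
by rewrite -(def_pblock tI BP xB) (def_pblock tI DP) // (fintype.subsetP CD) // (fintype.subsetP BC).
Qed.

Lemma is_pi1_exists (R : realType) (N : nat) (A : 'M[R[i]]_N) :
  exists P : {set {set 'I_N}}, is_pi1 A P.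
Proof.
pose e := fun i j : 'I_N => (row i A == row j A) && (col i A == col j A).
have eE i j : e i j -> forall k, A i k = A j k /\ A k i = A k j.
  case/andP=> /eqP/rowP r /eqP/colP c k.
  by split; [have := r k | have := c k]; rewrite !mxE.
have eqe : {in finset.setT & &, equivalence_rel e}.
  move=> x y z _ _ _; split; first by rewrite /e !eqxx.
  by case/andP=> /eqP rxy /eqP cxy; rewrite /e rxy cxy.
have part := equivalence_partitionP eqe.
exists (equivalence_partition e finset.setT); split => //.
- move=> I J IP JP.
  have /and3P[_ tI n0] := part.
  have /set0Pn[i iI] : I != finset.set0 by apply: contraNneq n0 => <-.
  have /set0Pn[j jJ] : J != finset.set0 by apply: contraNneq n0 => <-.
  exists (A i j) => i' j' iI' jJ'.
  have ei : e i i'.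
    rewrite -(pblock_equivalence_partition eqe) ?finset.in_setT //.
    by rewrite (def_pblock tI IP).
  have ej : e j j'.
    rewrite -(pblock_equivalence_partition eqe) ?finset.in_setT //.
    by rewrite (def_pblock tI JP).
  by have [<- _] := eE _ _ ei j'; have [_ <-] := eE _ _ ej i.
- move=> Q /and3P[/eqP covQ tQ n0] cQ B BQ.
  have /set0Pn[i iB] : B != finset.set0 by apply: contraNneq n0 => <-.
  exists (finset.pblock (equivalence_partition e finset.setT) i).
    by rewrite pblock_mem // (cover_partition part) finset.in_setT.
  apply/fintype.subsetP => j jB.
  rewrite (pblock_equivalence_partition eqe) ?finset.in_setT //.
  have inQ k : exists2 K, K \in Q & k \in K.
    have : k \in finset.cover Q by rewrite covQ finset.in_setT.
    by move=> kc; exists (finset.pblock Q k); rewrite ?pblock_mem ?mem_pblock.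
  apply/andP; split; apply/eqP/matrixP => a b; rewrite !mxE.
    have [K KQ bK] := inQ b; have [c cE] := cQ _ _ BQ KQ.
    by rewrite !cE.
  have [K KQ aK] := inQ a; have [c cE] := cQ _ _ KQ BQ.
  by rewrite !cE.
Qed.

(* Main.v *)
Require Import Defs.
From mathcomp Require Import all_boot all_order all_algebra.
From mathcomp Require Import all_classical reals.
From mathcomp Require Import perm.
From mathcomp Require Import ring.

Set Implicit Arguments.
Unset Strict Implicit.
Unset Printing Implicit Defensive.

Import Order.TTheory GRing.Theory Num.Theory.
Local Open Scope ring_scope.
Local Open Scope complex_scope.
Local Open Scope classical_set_scope.

(** Write i ~ j when i and j lie in the same block of pi, that is, when rows i
and j of A agree and columns i and j agree; a block of pi is called a class.
A vector lies in the kernel of J_pi exactly when its coordinates sum to zero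
over each class, so each of the other kernels has to be compared with these
class sums.

For a fixed row i, the numbers f (A i j) depend only on the class of j.  Hence
a vector whose class sums vanish is killed by every f[A], and also by the
block-diagonal part of f[A] along any partition coarser than pi
([mxker_weighted_sum]).

Conversely, take a vector v in one of the other kernels.  Full determinantal
rank over row i makes an invertible square system available, whose unknowns
are the sums of v over the level sets of row i; so all these sums vanish
([full_det_rank_level_sums]).  For the block-diagonal parts, f ranges over all
functions and an indicator isolates a level set directly.  The only level set
needed is L_i = {j : A i j = A i i}, intersected with the block of i in the
block-diagonal case.  Here 3-PMP enters, in two ways.

- If A i j = A i i, the 2 x 2 minor on i, j gives A i i <= A j j
  ([pmp_diag_le]).
- If moreover A j j = A i i =: a, then for any third index k the 3 x 3 minor
  on i, j, k equals - a |A i k - A j k|^2, so rows i and j agree when a > 0;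
  when a = 0 the 2 x 2 minors make both rows vanish ([pmp_row_eq]).  Thus
  i ~ j.

So L_i is the class of i together with classes of strictly larger diagonal
entry.  By induction, starting from the largest diagonal entries, the latter
contribute zero, and the class sum of i vanishes ([class_sums_eq0]).  Since
this criterion for i ~ j involves only the principal submatrix on i and j, it
makes no difference whether the whole of A or only its diagonal blocks are
seen.

The equality fails for the closed adjacency matrix of the path on five
vertices (entry 1 when |i - j| <= 1, and 0 otherwise).  Its 1 x 1 and 2 x 2
principal minors are 0 or 1, so the matrix is 2-PMP and the constant 3 cannot
be lowered to 2.  Its rows are distinct, so the kernel of J_pi is zero; but
the vector (1, -1, 0, 1, -1) sums to zero over each closed neighbourhood and
over the complement of each, so every f[A] kills it.  That the matrix is not
3-PMP then follows from the equality of kernels itself. *)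

(** * Partitions and block sums *)

Lemma is_partition_trivIset N (P : {set {set 'I_N}}) :
  is_partition P -> finset.trivIset P.
Proof. by case/and3P. Qed.

Lemma mem_pblock_id N (P : {set {set 'I_N}}) i :
  is_partition P -> i \in finset.pblock P i.
Proof. by move=> partP; rewrite mem_pblock (cover_partition partP) inE. Qed.

Lemma pblock_in N (P : {set {set 'I_N}}) i :
  is_partition P -> finset.pblock P i \in P.
Proof. by move=> partP; rewrite pblock_mem // (cover_partition partP) inE. Qed.

Lemma refines_pblock N (P Q : {set {set 'I_N}}) i :
  is_partition P -> is_partition Q -> refines P Q ->
  finset.pblock P i \subset finset.pblock Q i.
Proof.
move=> partP partQ /(_ _ (pblock_in i partP))[C CQ PC].
have iC : i \in C by apply: (fintype.subsetP PC); exact: mem_pblock_id.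
by rewrite (def_pblock (is_partition_trivIset partQ) CQ iC).
Qed.

(** For L a union of blocks, the sum over L splits along the blocks inside L. *)
Lemma sum_saturated_eq0 (V : nmodType) N (P : {set {set 'I_N}})
    (L : {set 'I_N}) (w : 'I_N -> V) :
  is_partition P ->
  (forall i, i \in L -> finset.pblock P i \subset L) ->
  (forall i, i \in L -> \sum_(j in finset.pblock P i) w j = 0) ->
  \sum_(j in L) w j = 0.
Proof.
move=> partP satL w0.
rewrite (partition_big (finset.pblock P)
          (fun B => [exists i in L, B == finset.pblock P i])) /=; last first.
  by move=> i iL; apply/existsP; exists i; rewrite iL eqxx.
apply: big1 => _ /existsP[i /andP[iL /eqP->]].
rewrite -[RHS](w0 i iL); apply: eq_bigl => j.
rewrite eq_sym eq_pblock ?is_partition_trivIset ?(cover_partition partP) ?inE //.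
apply/andP/idP => [[]//|ji]; split=> //.
exact: (fintype.subsetP (satL i iL)).
Qed.

Lemma block_diag_mul (R : realType) N (P : {set {set 'I_N}}) (M : 'M[R[i]]_N)
    (v : 'cV[R[i]]_N) i :
  is_partition P ->
  (block_diag P M *m v) i 0 = \sum_(j in finset.pblock P i) M i j * v j 0.
Proof.
move=> partP; rewrite !mxE [RHS]big_mkcond /=; apply: eq_bigr => j _.
rewrite !mxE; have -> : [exists B in P, (i \in B) && (j \in B)]
    = (j \in finset.pblock P i); last by case: ifP; rewrite ?mul0r.
apply/existsP/idP => [[B /and3P[BP iB jB]]|ji].
  by rewrite (def_pblock (is_partition_trivIset partP) BP iB).
by exists (finset.pblock P i); rewrite pblock_in // mem_pblock_id.
Qed.

Lemma mxker_block_diag1 (R : realType) N (P : {set {set 'I_N}})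
    (v : 'cV[R[i]]_N) :
  is_partition P ->
  mxker (block_diag P (const_mx 1)) v <->
  (forall i, \sum_(j in finset.pblock P i) v j 0 = 0).
Proof.
move=> partP.
have JE i : (block_diag P (const_mx 1) *m v) i 0
    = \sum_(j in finset.pblock P i) v j 0.
  by rewrite block_diag_mul //; apply: eq_bigr => j _; rewrite mxE mul1r.
split=> [Jv i|Jv]; first by rewrite -JE Jv mxE.
by rewrite /mxker /=; apply/matrixP => i j; rewrite (ord1 j) JE mxE.
Qed.

(** Agreeing rows and columns define an equivalence relation whose classes form
a block-constant partition, so the coarsest one cannot separate two equivalent
indices. *)
Lemma mem_pblock_pi1 (R : realType) N (A : 'M[R[i]]_N) P i j :
  is_pi1 A P ->
  (j \in finset.pblock P i) = (row i A == row j A) && (col i A == col j A).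
Proof.
case=> partP cP maxP; set e := fun i j : 'I_N =>
  (row i A == row j A) && (col i A == col j A).
have eE x y : e x y -> forall k, A x k = A y k /\ A k x = A k y.
  case/andP=> /eqP/rowP r /eqP/colP c k.
  by split; [have := r k | have := c k]; rewrite !mxE.
have eqe : {in finset.setT & &, equivalence_rel e}.
  move=> x y z _ _ _; split; first by rewrite /e !eqxx.
  by case/andP=> /eqP rxy /eqP cxy; rewrite /e rxy cxy.
have partQ := equivalence_partitionP eqe; set Q := equivalence_partition _ _ in partQ.
have QE x y : (y \in finset.pblock Q x) = e x y.
  by rewrite pblock_equivalence_partition ?inE.
apply/idP/idP => [ji | eij].
  have const k l : exists c, forall x y, x \in finset.pblock P k ->
      y \in finset.pblock P l -> A x y = c by apply: cP; exact: pblock_in.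
  have ii := mem_pblock_id i partP.
  apply/andP; split; apply/eqP/matrixP => a b; rewrite !mxE.
    have [c cE] := const i b; rewrite !cE //; exact: mem_pblock_id.
  have [c cE] := const a i; rewrite !cE //; exact: mem_pblock_id.
have cQ : block_constant A Q.
  move=> I J IQ JQ.
  have /and3P[_ tQ n0] := partQ.
  have /set0Pn[x xI] : I != finset.set0 by apply: contraNneq n0 => <-.
  have /set0Pn[y yJ] : J != finset.set0 by apply: contraNneq n0 => <-.
  exists (A x y) => x' y'; rewrite -(def_pblock tQ IQ xI) -(def_pblock tQ JQ yJ).
  by rewrite !QE => /eE/(_ y')[<- _] /eE/(_ x)[_ <-].
apply: (fintype.subsetP (refines_pblock i partQ partP (maxP _ partQ cQ))).
by rewrite QE.
Qed.

(** * Small principal minors *)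

(** Reordering rows and columns by the same permutation multiplies the
determinant twice by the same sign.  The sizes n and k are kept apart because
n will be the cardinal of a set, which equals k only propositionally. *)
Lemma det_mxsub_reindex (K : comPzRingType) N n k (M : 'M[K]_N)
    (f : 'I_n -> 'I_N) (g : 'I_k -> 'I_N) :
  n = k -> injective g -> (forall i, exists j, g i = f j) ->
  \det (mxsub f f M) = \det (mxsub g g M).
Proof.
move=> nk; subst k => g_inj /fin_all_exists[h gE].
have h_inj : injective h by move=> x y hxy; apply: g_inj; rewrite !gE hxy.
have -> : mxsub g g M = row_perm (perm h_inj) (col_perm (perm h_inj) (mxsub f f M)).
  by apply/matrixP => x y; rewrite !mxE !permE !gE.
rewrite row_permE col_permE !det_mulmx !det_perm odd_permV mulrC -mulrA.
by rewrite -expr2 sqrr_sign mulr1.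
Qed.

Lemma pmp_minor_ge0 (R : realType) N k n (A : 'M[R[i]]_N) (g : 'I_n -> 'I_N) :
  pmp k A -> (1 <= n <= k)%N -> injective g -> 0 <= \det (mxsub g g A).
Proof.
move=> pA nk g_inj; pose I := [set g x | x in finset.setT]%SET.
have cI : #|I| = n by rewrite card_imset // cardsT card_ord.
rewrite -(det_mxsub_reindex A (f := @enum_val _ (mem I))) ?(pA n) //.
move=> x; have gI : g x \in I by apply: imset_f; rewrite inE.
by exists (enum_rank_in gI (g x)); rewrite enum_rankK_in.
Qed.

Lemma det2 (K : comPzRingType) (M : 'M[K]_2) :
  \det M = M 0 0 * M 1 1 - M 0 1 * M 1 0.
Proof.
rewrite (expand_det_row _ 0) !big_ord_recl big_ord0 /cofactor !det_mx11 !mxE /=.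
rewrite addr0 expr0 expr1 mul1r mulN1r mulrN.
by congr (M _ _ * M _ _ - M _ _ * M _ _); apply: val_inj.
Qed.

Lemma det3 (K : comNzRingType) (M : 'M[K]_3) :
  \det M
    = M 0 0 * (M 1 1 * M ord_max ord_max - M 1 ord_max * M ord_max 1)
    - M 0 1 * (M 1 0 * M ord_max ord_max - M 1 ord_max * M ord_max 0)
    + M 0 ord_max * (M 1 0 * M ord_max 1 - M 1 1 * M ord_max 0).
Proof.
rewrite (expand_det_row _ 0) !big_ord_recl big_ord0 /cofactor !det2 !mxE /=.
have e1 : lift 0 0 = 1 :> 'I_3 by apply: val_inj.
have e2 : lift 0 1 = ord_max :> 'I_3 by apply: val_inj.
have e3 : lift 1 0 = 0 :> 'I_3 by apply: val_inj.
have e4 : lift 1 1 = ord_max :> 'I_3 by apply: val_inj.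
have e5 : lift (ord_max : 'I_3) 0 = 0 :> 'I_3 by apply: val_inj.
have e6 : lift (ord_max : 'I_3) 1 = 1 :> 'I_3 by apply: val_inj.
have e7 : lift 0 (lift 0 0) = ord_max :> 'I_3 by apply: val_inj.
have e8 : lift 0 (0 : 'I_1) = 1 :> 'I_2 by apply: val_inj.
rewrite ?(e7, e8, e1, e2, e3, e4, e5, e6) /=.
ring.
Qed.

(** * Matrices with non-negative principal minors up to order three *)

Lemma hermsymmx_conj (R : realType) N (A : 'M[R[i]]_N) i j :
  A \is hermsymmx -> A j i = (A i j)^*.
Proof. by rewrite is_hermitianmxE => /eqP {1}->; rewrite expr0 scale1r !mxE. Qed.

Section ThreePMP.
Variables (R : realType) (N : nat) (A : 'M[R[i]]_N).
Hypotheses (hermA : A \is hermsymmx) (pmpA : pmp 3 A).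

Lemma pmp_diag_ge0 i : 0 <= A i i.
Proof.
have := @pmp_minor_ge0 _ _ _ 1 _ (fun=> i) pmpA isT.
by rewrite det_mx11 !mxE; apply=> x y _; rewrite !ord1.
Qed.

Lemma pmp_minor2 i j : i != j -> `|A i j| ^+ 2 <= A i i * A j j.
Proof.
move=> ij; have := @pmp_minor_ge0 _ _ _ 2 _ (tnth [tuple i; j]) pmpA isT.
rewrite det2 !mxE !(tnth_nth i) /= (hermsymmx_conj i j) // -normCK subr_ge0.
by apply; apply/tuple_uniqP; rewrite /= inE ij.
Qed.

Lemma pmp_diag0_row i j : A i i = 0 -> A i j = 0.
Proof.
have [<-//|ij] := eqVneq i j => Ai0; have := pmp_minor2 ij.
rewrite Ai0 mul0r => le0; apply/eqP; rewrite -normr_eq0 -sqrf_eq0.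
by rewrite eq_le le0 exprn_ge0.
Qed.

Lemma pmp_diag_le i j : A i j = A i i -> A i i <= A j j.
Proof.
have [<-//|ij Aij] := eqVneq i j; have := pmp_minor2 ij.
have := pmp_diag_ge0 i; rewrite Aij le_eqVlt => /predU1P[<- _|Ai_gt0].
  exact: pmp_diag_ge0.
by rewrite (ger0_norm (ltW Ai_gt0)) expr2 ler_pM2l.
Qed.

(** For k distinct from i and j, the 3 x 3 minor is that of
[[a, a, b], [a, a, c], [b^*, c^*, d]], namely - a |b - c|^2. *)
Lemma pmp_row_eq i j : A i j = A i i -> A j j = A i i -> row i A = row j A.
Proof.
move=> Aij Ajj; apply/rowP => k; rewrite !mxE.
have [<-//|ij] := eqVneq i j.
have Ai_conj : (A i i)^* = A i i by rewrite -hermsymmx_conj.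
have Aji : A j i = A i i by rewrite (hermsymmx_conj i j) // Aij.
have [<-//|ik] := eqVneq i k; have [<-|jk] := eqVneq j k; first by rewrite Aij.
have := pmp_diag_ge0 i; rewrite le_eqVlt => /predU1P[A0|Ai_gt0].
  by rewrite (pmp_diag0_row k (esym A0)) (pmp_diag0_row k) // Ajj.
have := @pmp_minor_ge0 _ _ _ 3 _ (tnth [tuple i; j; k]) pmpA isT.
rewrite det3 !mxE !(tnth_nth i) /=.
rewrite Aij Aji Ajj (hermsymmx_conj i k) // (hermsymmx_conj j k) //.
move=> /(_ _)/wrap[|det_ge0].
  by apply/tuple_uniqP; rewrite /= !inE negb_or ij ik jk.
have : 0 <= - (A i i * `|A i k - A j k| ^+ 2).
  rewrite normCK rmorphB; apply: le_trans det_ge0 _.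
  by rewrite le_eqVlt; apply/predU1P; left; ring.
rewrite oppr_ge0 pmulr_rle0 // => le0; apply/eqP; rewrite -subr_eq0.
by rewrite -normr_eq0 -sqrf_eq0 eq_le le0 exprn_ge0.
Qed.

Lemma mem_pblock_pi1_pmp P i j :
  is_pi1 A P -> A i j = A i i -> A j j = A i i -> j \in finset.pblock P i.
Proof.
move=> piP Aij Ajj; have rij := pmp_row_eq Aij Ajj.
rewrite (mem_pblock_pi1 _ _ piP) rij eqxx; apply/eqP/colP => k.
by rewrite !mxE !(hermsymmx_conj _ k) //; have /rowP/(_ k) := rij; rewrite !mxE => ->.
Qed.

(** The set L i consists of the class of i and of classes with a strictly larger
diagonal entry, which allows an induction on the number of diagonal entries
above A i i. *)
Lemma class_sums_eq0 (V : zmodType) P (L : 'I_N -> {set 'I_N}) (w : 'I_N -> V) :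
  is_pi1 A P ->
  (forall i, i \in L i) ->
  (forall i j, j \in L i -> A i j = A i i) ->
  (forall i j, j \in L i -> finset.pblock P j \subset L i) ->
  (forall i, \sum_(j in L i) w j = 0) ->
  forall i, \sum_(j in finset.pblock P i) w j = 0.
Proof.
move=> piP Lid Lrow Lsat Lsum i; have [partP _ _] := piP.
have tP := is_partition_trivIset partP.
have [n] := ubnP #|[set k | A i i < A k k]%SET|; elim: n => // n IHn in i *.
rewrite ltnS => le_n; have sub := Lsat _ _ (Lid i).
have := Lsum i; rewrite (big_setID (finset.pblock P i)) /=.
rewrite (finset.setIidPr sub) [X in _ + X](@sum_saturated_eq0 _ _ P) ?addr0 //.
  move=> j; rewrite inE => /andP[jNi jL].
  apply/fintype.subsetP => k kj; rewrite inE (fintype.subsetP (Lsat _ _ jL)) // andbT.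
  apply: contraNN jNi => ki.
  by rewrite -(same_pblock tP ki) (same_pblock tP kj) mem_pblock_id.
move=> j; rewrite inE => /andP[jNi jL]; apply: IHn; apply: leq_trans le_n.
have Aij := Lrow _ _ jL.
have lt_ij : A i i < A j j.
  rewrite lt_neqAle (pmp_diag_le Aij) andbT; apply: contraNneq jNi => Ajj.
  exact: mem_pblock_pi1_pmp.
apply: proper_card; apply/fintype.properP; split.
  by apply/fintype.subsetP => k; rewrite !inE; apply: lt_trans.
by exists j; rewrite !inE ?ltxx.
Qed.

End ThreePMP.

(** * Level sets of a row *)

(** Grouping the indices by the value of y turns the hypothesis into a linear
system in the level sums, one equation for each f in F; full determinantal
rank over the distinct values of y selects an invertible square subsystem. *)
Lemma full_det_rank_level_sums (R : realType) (D : choiceType)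
    (F : set (D -> R[i])) N (y : 'I_N -> D) (w : 'I_N -> R[i]) :
  full_det_rank F (range y) ->
  (forall f, F f -> \sum_j f (y j) * w j = 0) ->
  forall d, \sum_(j | y j == d) w j = 0.
Proof.
move=> rankF Fw d; pose s := undup (codom y).
have ys j : (index (y j) s < size s)%N.
  by rewrite index_mem mem_undup codom_f.
pose p j := Ordinal (ys j); pose x := tnth (in_tuple s).
have xp j : x (p j) = y j by rewrite /x (tnth_nth (y j)) nth_index // -index_mem.
have x_inj : injective x by apply/tuple_uniqP; exact: undup_uniq.
have xy l : range y (x l).
  have : x l \in s by exact: mem_tnth.
  by rewrite mem_undup => /codomP[j ->]; exists j.
have [_ [f [Ff detf]]] := rankF _ x x_inj xy.
pose t := \col_l \sum_(j | p j == l) w j.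
have Mt0 : (\matrix_(i, l) f i (x l)) *m t = 0.
  apply/matrixP => i c; rewrite !mxE -[RHS](Fw _ (Ff i)).
  rewrite [RHS](partition_big p predT) //=; apply: eq_bigr => l _.
  rewrite !mxE big_distrr /=; apply: eq_bigr => j /eqP<-.
  by rewrite xp.
have t0 : t = 0.
  have unitM : \matrix_(i, l) f i (x l) \in unitmx by rewrite unitmxE unitfE.
  by rewrite -[t](mulKmx unitM) Mt0 mulmx0.
have [ds|dNs] := boolP (d \in s); last first.
  rewrite big_pred0 // => j; apply: contraNF dNs => /eqP<-.
  by rewrite mem_undup codom_f.
have ltd : (index d s < size s)%N by rewrite index_mem.
have /colP/(_ (Ordinal ltd)) := t0; rewrite !mxE => {2}<-; apply: eq_bigl => j.
apply/eqP/eqP => [yj|/(congr1 x)]; first by apply: val_inj; rewrite /= yj.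
by rewrite xp => ->; rewrite /x (tnth_nth d) /= nth_index.
Qed.

(** * The kernels as vanishing class sums *)

Section Kernels.
Variables (R : realType) (N : nat) (A : 'M[R[i]]_N) (P : {set {set 'I_N}}).
Hypotheses (hermA : A \is hermsymmx) (pmpA : pmp 3 A) (piP : is_pi1 A P).

Let partP : is_partition P. Proof. by case: piP. Qed.

Lemma pblock_pi1_entry i j k : k \in finset.pblock P j -> A i j = A i k.
Proof.
rewrite (mem_pblock_pi1 _ _ piP) => /andP[_ /eqP/colP/(_ i)].
by rewrite !mxE.
Qed.

(** S i is the set of columns seen from row i: everything for the full matrices,
the block of i for the block-diagonal ones. *)
Lemma diag_level_sums_mxker (S : 'I_N -> {set 'I_N}) (v : 'cV[R[i]]_N) :
  (forall i, i \in S i) ->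
  (forall i j, j \in S i -> finset.pblock P j \subset S i) ->
  (forall i, \sum_(j in S i | A i j == A i i) v j 0 = 0) ->
  mxker (block_diag P (const_mx 1)) v.
Proof.
move=> Sid Ssat Ssum; apply/mxker_block_diag1 => //.
pose L i := [set j in S i | A i j == A i i]%SET.
apply: (class_sums_eq0 hermA pmpA (L := L)) => // [i|i j|i j|i].
- by rewrite inE Sid eqxx.
- by rewrite inE => /andP[_ /eqP].
- rewrite inE => /andP[jS /eqP Aij]; apply/fintype.subsetP => k kj.
  by rewrite inE (fintype.subsetP (Ssat _ _ jS)) // -(pblock_pi1_entry i kj) Aij eqxx.
- by rewrite -[RHS](Ssum i); apply: eq_bigl => j; rewrite inE.
Qed.

Lemma mxker_weighted_sum (L : {set 'I_N}) (f : entries A -> R[i]) (v : 'cV[R[i]]_N) i :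
  mxker (block_diag P (const_mx 1)) v ->
  (forall j, j \in L -> finset.pblock P j \subset L) ->
  \sum_(j in L) apply_mx A f i j * v j 0 = 0.
Proof.
move=> /(mxker_block_diag1 _ partP) v0 Lsat.
apply: (sum_saturated_eq0 partP) => // k _.
transitivity (f (entry A i k) * \sum_(j in finset.pblock P k) v j 0); last first.
  by rewrite v0 mulr0.
rewrite big_distrr /=; apply: eq_bigr => j jk; rewrite mxE.
suff -> : entry A i j = entry A i k by [].
by apply: val_inj; rewrite /= (pblock_pi1_entry i jk).
Qed.

Lemma simker_apply_mx (F : set (entries A -> R[i])) :
  (forall i, full_det_rank F (row_entries A i)) ->
  simker F (apply_mx A) = mxker (block_diag P (const_mx 1)).
Proof.
move=> rankF; apply/seteqP; split=> v kv; last first.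
  move=> f _; rewrite /mxker /=; apply/matrixP => i c; rewrite (ord1 c) !mxE.
  rewrite -[RHS](@mxker_weighted_sum [set: 'I_N]%SET f v i) //.
  by apply: eq_bigl => j; rewrite inE.
apply: (@diag_level_sums_mxker (fun=> [set: 'I_N]%SET)) => // i; first by rewrite inE.
rewrite -[RHS](@full_det_rank_level_sums _ _ _ _ (entry A i) (fun j => v j 0)
  (rankF i) _ (entry A i i)).
  by apply: eq_bigl => j; rewrite inE -val_eqE.
move=> f Ff; have /colP/(_ i) := kv f Ff; rewrite !mxE => {2}<-.
by apply: eq_bigr => j _; rewrite mxE.
Qed.

Lemma simker_block_diag (Q : {set {set 'I_N}}) :
  is_partition Q -> refines P Q ->
  simker setT (fun f => block_diag Q (apply_mx A f))
    = mxker (block_diag P (const_mx 1)).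
Proof.
move=> partQ PQ.
have Qsat i j : j \in finset.pblock Q i -> finset.pblock P j \subset finset.pblock Q i.
  move=> ji; rewrite -(same_pblock (is_partition_trivIset partQ) ji).
  exact: refines_pblock.
apply/seteqP; split=> v kv; last first.
  move=> f _; rewrite /mxker /=; apply/matrixP => i c; rewrite (ord1 c).
  rewrite block_diag_mul // [RHS]mxE; apply: mxker_weighted_sum kv _ => j.
  exact: Qsat.
apply: (@diag_level_sums_mxker (finset.pblock Q)) => // i; first exact: mem_pblock_id.
(* The indicator of the value A i i isolates its level set in row i. *)
have /colP/(_ i) := kv (fun z => (val z == A i i)%:R) I.
rewrite block_diag_mul // [X in _ = X]mxE => {2}<-.
rewrite big_mkcondr; apply: eq_bigr => j _.
by rewrite mxE /=; case: eqP; rewrite ?mul1r ?mul0r.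
Qed.

End Kernels.

(** * The path on five vertices *)

(** The indicators of the k given points yield the identity matrix. *)
Lemma full_det_rank_setT (R : realType) (D : Type) (Y : set D) :
  full_det_rank (R := R) setT Y.
Proof.
move=> k x x_inj _.
pose f (i : 'I_k) (d : D) : R[i] := `[< d = x i >]%:R.
have fx i j : f i (x j) = (i == j)%:R.
  rewrite /f; congr (_%:R); congr nat_of_bool.
  by apply/asboolP/eqP => [/x_inj->|->].
split; last first.
  exists f; split=> //; have -> : \matrix_(i, j) f i (x j) = 1%:M.
    by apply/matrixP => i j; rewrite !mxE fx.
  by rewrite det1 oner_neq0.
have f_inj : {in [set: 'I_k] &, injective f}.
  move=> i j _ _ fij; have /eqP := fx i j; rewrite fij fx eqxx.
  by have [//|_] := eqVneq i j; rewrite oner_eq0.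
by rewrite -(card_le_eql (inj_card_eq f_inj)) subset_card_le.
Qed.

Definition path_mx (R : realType) : 'M[R[i]]_5 :=
  \matrix_(i, j) ((i <= j.+1) && (j <= i.+1))%N%:R.

Definition path_vec (R : realType) : 'cV[R[i]]_5 :=
  \col_i [:: 1; -1; 0; 1; -1]`_i.

Lemma path_mx_herm (R : realType) : path_mx R \is hermsymmx.
Proof.
rewrite is_hermitianmxE; apply/eqP/matrixP => i j.
by rewrite expr0 scale1r !mxE conjC_nat andbC.
Qed.

(** The matrix takes only two values, so each row of f[A] is a combination of the
indicators of a closed neighbourhood and of its complement; the vector sums to
zero over both. *)
Lemma path_vec_simker (R : realType) :
  simker setT (apply_mx (path_mx R)) (path_vec R).
Proof.
(* Columns 0 and 4 of row 0 serve as representatives of the values 1 and 0. *)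
move=> f _; have fE i j : apply_mx (path_mx R) f i j
  = if (i <= j.+1)%N && (j <= i.+1)%N
    then f (entry (path_mx R) 0 0) else f (entry (path_mx R) 0 ord_max).
  rewrite mxE; case: ifP => ij; congr f; apply: val_inj; by rewrite /= !mxE ij.
rewrite /mxker /=; apply/colP => i; rewrite !mxE.
rewrite !big_ord_recl big_ord0 !fE !mxE /=.
by case: i => [[|[|[|[|[|]]]]] ?] //=; ring.
Qed.

Lemma path_vec_mxker (R : realType) P :
  is_pi1 (path_mx R) P -> ~ mxker (block_diag P (const_mx 1)) (path_vec R).
Proof.
move=> piP; have [partP _ _] := piP => /(mxker_block_diag1 _ partP)/(_ 0).
rewrite (bigD1 0) ?mem_pblock_id //= big1; last first.
  move=> j /andP[]; rewrite (mem_pblock_pi1 _ _ piP) => /andP[/eqP/rowP r _].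
  (* Row j > 0 differs from row 0 in column max(2, j), where row 0 is zero. *)
  have := r (inord (maxn 2 j)); rewrite !mxE inordK ?gtn_max ?ltn_ord //.
  case: j {r} => [[|[|[|[|[|]]]]] ?] //= /eqP; rewrite eq_sym ?oner_eq0 //.
by rewrite addr0 mxE /= => /eqP; rewrite oner_eq0.
Qed.


Theorem theorem3p7 (R : realType) :
  (forall (N : nat) (A : 'M[R[i]]_N) (pi pi' : {set {set 'I_N}})
          (F : set (entries A -> R[i])),
    (1 <= N)%N ->
    A \is hermsymmx ->
    pmp 3 A ->
    is_pi1 A pi ->
    is_partition pi' ->
    refines pi pi' ->
    (forall i : 'I_N, full_det_rank F (row_entries A i)) ->
    [/\ simker F (apply_mx A) = simker setT (apply_mx A),
        simker setT (apply_mx A)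
          = simker setT (fun f : entries A -> R[i] =>
                           block_diag pi' (apply_mx A f)) &
        simker setT (fun f : entries A -> R[i] =>
                       block_diag pi' (apply_mx A f))
          = mxker (block_diag pi (const_mx 1))])
  /\
  (exists (N : nat) (A : 'M[R[i]]_N) (pi pi' : {set {set 'I_N}})
          (F : set (entries A -> R[i])),
    [/\ (1 <= N)%N, A \is hermsymmx & ~ pmp 3 A] /\
    [/\ is_pi1 A pi, is_partition pi' & refines pi pi'] /\
    (forall i : 'I_N, full_det_rank F (row_entries A i)) /\
    ~ [/\ simker F (apply_mx A) = simker setT (apply_mx A),
          simker setT (apply_mx A)
            = simker setT (fun f : entries A -> R[i] =>
                             block_diag pi' (apply_mx A f)) &
          simker setT (fun f : entries A -> R[i] =>
                         block_diag pi' (apply_mx A f))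
            = mxker (block_diag pi (const_mx 1))]).
Proof.
have equal N (A : 'M[R[i]]_N) pi pi' (F : set (entries A -> R[i])) :
    A \is hermsymmx -> pmp 3 A -> is_pi1 A pi -> is_partition pi' ->
    refines pi pi' -> (forall i, full_det_rank F (row_entries A i)) ->
    [/\ simker F (apply_mx A) = simker setT (apply_mx A),
        simker setT (apply_mx A)
          = simker setT (fun f => block_diag pi' (apply_mx A f)) &
        simker setT (fun f => block_diag pi' (apply_mx A f))
          = mxker (block_diag pi (const_mx 1))].
  move=> hermA pmpA piP partQ PQ rankF.
  have rankT i := @full_det_rank_setT R _ (row_entries A i).
  by rewrite !(simker_apply_mx hermA pmpA piP) // !(simker_block_diag hermA pmpA piP).
split=> [N A pi pi' F _|]; first exact: equal.
have [P piP] := is_pi1_exists (path_mx R); have [partP _ _] := piP.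
have PP : refines P P by move=> B BP; exists B.
have rankT i := @full_det_rank_setT R _ (row_entries (path_mx R) i).
have fails : ~ [/\ simker setT (apply_mx (path_mx R)) = simker setT (apply_mx (path_mx R)),
    simker setT (apply_mx (path_mx R))
      = simker setT (fun f => block_diag P (apply_mx (path_mx R) f)) &
    simker setT (fun f => block_diag P (apply_mx (path_mx R) f))
      = mxker (block_diag P (const_mx 1))].
  case=> _ e23 e34; apply: (path_vec_mxker piP).
  rewrite -e34 -e23; exact: path_vec_simker.
exists 5, (path_mx R), P, P, setT; split; last by [].
split=> //; first exact: path_mx_herm.
by move=> pmpA; apply: fails; apply: equal => //; exact: path_mx_herm.
Qed.
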